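(* For all positive integers $d,r,k$ with $1\le r\le k\le d$, the set $\mathcal{CR}2$ (defined in the context, for these $d,r,k$) is second-order cone representable, and $$\mathrm{conv}(\mathcal{F})\;\subseteq\;\mathcal{CR}2\;\subseteq\;\rho_{\mathcal{CR}2}\cdot\mathrm{conv}(\mathcal{F})$$ for some $\rho_{\mathcal{CR}2}\le 2\sqrt{r}$.
   Context: All matrices are real. For $V\in\mathbb{R}^{d\times r}$, $V_{i,:}$ denotes the $i$-th row and $V_{:,j}$ the $j$-th column, and $\|V\|_0$ denotes the number of non-zero rows of $V$. $[r]=\{1,\dots,r\}$, $I^r$ is the $r\times r$ identity matrix, $\mathrm{conv}$ is the convex hull, and $\rho\cdot S=\{\rho x: x\in S\}$. A set is second-order cone representable if it is the projection of a set defined by finitely many linear and second-order cone constraints (a second-order cone constraint being $\|Bx+b\|_2\le c^\top x+e$). $\mathcal{F}=\{V\in\mathbb{R}^{d\times r}: V^\top V=I^r,\ \|V\|_0\le k\}$. $\mathcal{CR}2$ is the set of all $V\in\mathbb{R}^{d\times r}$ such that $\|V_{:,j}\|_2^2\le 1$ for all $j\in[r]$; $\|V_{:,j_1}+ V_{:,j_2}\|_2^2\le 2$ and $\|V_{:,j_1}- V_{:,j_2}\|_2^2\le 2$ for all $j_1\ne j_2\in[r]$; $\|V_{:,j}\|_1\le\sqrt{k}$ for all $j\in[r]$; and $\sum_{i=1}^d\|V_{i,:}\|_2\le\sqrt{rk}$. *)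

(* Defs.v *)
From mathcomp Require Import all_boot all_order all_algebra.
From mathcomp Require Import boolp classical_sets reals convex.

Set Implicit Arguments.
Unset Strict Implicit.
Unset Printing Implicit Defensive.

Import Order.TTheory GRing.Theory Num.Theory.

Local Open Scope classical_set_scope.
Local Open Scope ring_scope.

Definition conv_hull (R : numDomainType) (M : lmodType R) (S : set M) : set M :=
  smallest (@convex_set R M) S.

Definition scale_set (R : numDomainType) (M : lmodType R) (rho : R)
    (S : set M) : set M :=
  [set rho *: x | x in S].

(* The norm of a matrix in MathComp-Analysis is the sup norm. The norms below
   are entrywise, hence the usual l2 and l1 norms on rows and columns. *)
Definition l2norm (R : realType) (m n : nat) (A : 'M[R]_(m, n)) : R :=
  Num.sqrt (\sum_i \sum_j A i j ^+ 2).

Definition l1norm (R : realType) (m n : nat) (A : 'M[R]_(m, n)) : R :=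
  \sum_i \sum_j `|A i j|.

Definition row_sparsity (R : realType) (d r : nat) (V : 'M[R]_(d, r)) : nat :=
  #|[set i : 'I_d | row i V != 0]%SET|.

Inductive constraint (R : realType) (n : nat) : Type :=
| LinearLe (a : 'cV[R]_n) (e : R)
| LinearEq (a : 'cV[R]_n) (e : R)
| SecondOrderCone (p : nat) (B : 'M[R]_(p, n)) (b : 'cV[R]_p)
    (c : 'cV[R]_n) (e : R).

Definition dotv (R : realType) (n : nat) (a x : 'cV[R]_n) : R :=
  \sum_i a i 0 * x i 0.

Definition satisfies (R : realType) (n : nat) (x : 'cV[R]_n)
    (g : constraint R n) : Prop :=
  match g with
  | LinearLe a e => dotv a x <= e
  | LinearEq a e => dotv a x = e
  | SecondOrderCone p B b c e => l2norm (B *m x + b) <= dotv c x + e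
  end.

(* Matrices are flattened by mxvec to points of R^(m * n); the projection
   forgets the l auxiliary coordinates y. *)
Definition soc_representable (R : realType) (m n : nat)
    (S : set 'M[R]_(m, n)) : Prop :=
  exists (l q : nat) (g : 'I_q -> constraint R (m * n + l)),
    S = [set V | exists y : 'cV[R]_l,
           forall i : 'I_q, satisfies (col_mx (mxvec V)^T y) (g i)].

Definition calF (R : realType) (d r k : nat) : set 'M[R]_(d, r) :=
  [set V | V^T *m V = 1%:M /\ (row_sparsity V <= k)%N].

Definition CR2 (R : realType) (d r k : nat) : set 'M[R]_(d, r) :=
  [set V | [/\ forall j : 'I_r, l2norm (col j V) ^+ 2 <= 1,
               forall j1 j2 : 'I_r, j1 != j2 ->
                 l2norm (col j1 V + col j2 V) ^+ 2 <= 2 /\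
                 l2norm (col j1 V - col j2 V) ^+ 2 <= 2,
               forall j : 'I_r, l1norm (col j V) <= Num.sqrt k%:R
             & \sum_(i < d) l2norm (row i V) <= Num.sqrt (r * k)%:R]].

(* Main.v *)
(* A row-sparse [V] with orthonormal columns satisfies the l1 and row-norm
   constraints by Cauchy-Schwarz over its nonzero rows, and CR2 is convex; this
   gives the first inclusion.  For the second, cut [V] in CR2 into blocks of [k]
   rows of decreasing norm.  The first block has Frobenius norm at most
   sqrt r; the Frobenius norm of each later block is at most the sum of the row
   norms of the preceding one divided by sqrt k, so these add up to at most
   sqrt (r k) / sqrt k = sqrt r.  It remains to see that the Frobenius unit ball
   of matrices supported on [k] rows lies in conv F.  Splitting off one singular
   value at a time by orthogonal maps reduces this to the fact that a scalar in
   [0, 1] is a convex combination of 1 and -1. *)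

Require Import Defs.
From HB Require Import structures.
From mathcomp Require Import all_boot all_order all_algebra.
From mathcomp Require Import boolp classical_sets reals convex.
From mathcomp Require Import interval_inference topology normedtype derive.
From mathcomp Require Import ring lra.

Set Implicit Arguments.
Unset Strict Implicit.
Unset Printing Implicit Defensive.

Import Order.TTheory GRing.Theory Num.Theory.
Import numFieldNormedType.Exports.

Local Open Scope classical_set_scope.
Local Open Scope ring_scope.

(** * The Cauchy-Schwarz inequality and the Frobenius norm *)

(** With [P], [A], [B] the three sums, the squares [(B a_i - P b_i)^2] add up to [B (A B - P^2)],
    which is therefore nonnegative. If [B > 0] it can be cancelled; if [B = 0] then [b = 0]. *)
Lemma Cauchy_Schwarz (R : realType) (I : finType) (a b : I -> R) :
  (\sum_i a i * b i) ^+ 2 <= (\sum_i a i ^+ 2) * (\sum_i b i ^+ 2).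
Proof.
set P := \sum_i _ * _; set A := \sum_i a _ ^+ _; set B := \sum_i b _ ^+ _.
have B_ge0 : 0 <= B by apply: sumr_ge0 => i _; rewrite sqr_ge0.
have [B0|B_neq0] := eqVneq B 0.
  have b0 i : b i = 0.
    by apply/eqP; rewrite -sqrf_eq0; have /allP := etrans
      (esym (psumr_eq0 _ (fun j _ => sqr_ge0 (b j)))) (introT eqP B0);
      move=> /(_ i (mem_index_enum i)).
  by rewrite B0 mulr0 /P big1 ?expr0n// => i _; rewrite b0 mulr0.
have : 0 <= \sum_i (B * a i - P * b i) ^+ 2.
  by apply: sumr_ge0 => i _; rewrite sqr_ge0.
have -> : \sum_i (B * a i - P * b i) ^+ 2 = B * (A * B - P ^+ 2).
  under eq_bigr => i _.
    have -> : (B * a i - P * b i) ^+ 2 =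
      B ^+ 2 * a i ^+ 2 - (2 * B * P) * (a i * b i) + P ^+ 2 * b i ^+ 2 by ring.
    over.
  rewrite big_split/= sumrB -!mulr_sumr -/A -/B -/P; ring.
by rewrite pmulr_rge0 ?subr_ge0// lt_def B_neq0.
Qed.

Section l2norm_theory.
Variables (R : realType) (m n : nat).
Implicit Types A B : 'M[R]_(m, n).

Lemma l2norm_ge0 A : 0 <= l2norm A. Proof. exact: sqrtr_ge0. Qed.

Lemma sum_sqr_ge0 A : 0 <= \sum_i \sum_j A i j ^+ 2.
Proof. by apply: sumr_ge0 => i _; apply: sumr_ge0 => j _; rewrite sqr_ge0. Qed.

Lemma l2norm_sqr A : l2norm A ^+ 2 = \sum_i \sum_j A i j ^+ 2.
Proof. by rewrite sqr_sqrtr// sum_sqr_ge0. Qed.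

Lemma l2norm0 : l2norm (0 : 'M[R]_(m, n)) = 0.
Proof.
by rewrite /l2norm big1 ?sqrtr0// => i _; rewrite big1// => j _;
  rewrite mxE expr0n.
Qed.

Lemma l2norm_eq0 A : l2norm A = 0 -> A = 0.
Proof.
move=> A0; have /eqP := l2norm_sqr A.
rewrite A0 expr0n eq_sym psumr_eq0 => [/allP A0'|i _]; last first.
  by apply: sumr_ge0 => j _; rewrite sqr_ge0.
apply/matrixP => i j; have := A0' i (mem_index_enum i).
rewrite psumr_eq0 => [/allP /(_ j (mem_index_enum j))|k _]; last exact: sqr_ge0.
by rewrite sqrf_eq0 mxE => /eqP.
Qed.

Lemma l2normZ (t : R) A : l2norm (t *: A) = `|t| * l2norm A.
Proof.
apply/eqP; rewrite -(@eqrXn2 _ 2) ?mulr_ge0 ?l2norm_ge0 ?normr_ge0//.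
rewrite exprMn !l2norm_sqr real_normK ?num_real// mulr_sumr.
apply/eqP/eq_bigr => i _; rewrite mulr_sumr; apply: eq_bigr => j _.
by rewrite mxE exprMn.
Qed.

Lemma l2norm_le (c : R) A :
  0 <= c -> (l2norm A <= c) = (\sum_i \sum_j A i j ^+ 2 <= c ^+ 2).
Proof. by move=> c0; rewrite -l2norm_sqr ler_sqr ?nnegrE ?l2norm_ge0. Qed.

Lemma l2normD A B : l2norm (A + B) <= l2norm A + l2norm B.
Proof.
rewrite l2norm_le ?addr_ge0 ?l2norm_ge0//.
set P := \sum_i \sum_j A i j * B i j.
have -> : \sum_i \sum_j (A + B) i j ^+ 2 =
    l2norm A ^+ 2 + l2norm B ^+ 2 + 2 * P.
  rewrite !l2norm_sqr mulr_sumr -!big_split/=; apply: eq_bigr => i _.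
  rewrite mulr_sumr -!big_split/=; apply: eq_bigr => j _.
  by rewrite mxE; ring.
suff : P <= l2norm A * l2norm B by move=> ?; nra.
rewrite (le_trans (ler_norm _))// -ler_sqr ?nnegrE ?mulr_ge0 ?l2norm_ge0//.
rewrite real_normK ?num_real// exprMn !l2norm_sqr /P !pair_big/=.
exact: (Cauchy_Schwarz (fun p : 'I_m * 'I_n => A p.1 p.2)).
Qed.

Lemma l2norm_conv (t : R) A B : 0 <= t -> t <= 1 ->
  l2norm (t *: A + (1 - t) *: B) <= t * l2norm A + (1 - t) * l2norm B.
Proof.
move=> t0 t1; apply: le_trans (l2normD _ _) _.
by rewrite !l2normZ !ger0_norm// subr_ge0.
Qed.

End l2norm_theory.

(** * Convex sets and convex hulls *)

Section convexity.
Variable R : realType.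

Lemma convex_setP (M : lmodType R) (C : set M) :
  @convex_set R M C <-> (forall (t : R) x y, 0 <= t -> t <= 1 ->
     C x -> C y -> C (t *: x + (1 - t) *: y)).
Proof.
split=> [cC t x y t0 t1 Cx Cy|cC x y t].
  by have := cC x y (Itv01 t0 t1); rewrite !inE => /(_ Cx Cy).
by rewrite !inE => Cx Cy; apply: cC.
Qed.

Lemma conv_hull_convex (M : lmodType R) (S : set M) (t : R) x y :
  0 <= t -> t <= 1 -> conv_hull S x -> conv_hull S y ->
  conv_hull S (t *: x + (1 - t) *: y).
Proof.
move=> t0 t1 Sx Sy C [cC SC].
by move/convex_setP : (cC); apply => //; [apply: Sx|apply: Sy].
Qed.

End convexity.
Lemma ler_conv (R : realType) (t a b c : R) : 0 <= t -> t <= 1 ->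
  a <= c -> b <= c -> t * a + (1 - t) * b <= c.
Proof. by move=> *; nra. Qed.

(** * First inclusion: the hull of [calF] lies in [CR2] *)

Section CR2_outer.
Variables (R : realType) (d r k : nat).
Implicit Types V : 'M[R]_(d, r).

Lemma CR2_convex : @convex_set R 'M[R]_(d, r) (@CR2 R d r k).
Proof.
apply/convex_setP => t V W t0 t1 [V1 V2 V3 V4] [W1 W2 W3 W4].
have sqr_conv m n (A B : 'M[R]_(m, n)) c : l2norm A ^+ 2 <= c ->
    l2norm B ^+ 2 <= c -> l2norm (t *: A + (1 - t) *: B) ^+ 2 <= c.
  move=> Ac Bc; have := l2norm_conv A B t0 t1.
  have := l2norm_ge0 (t *: A + (1 - t) *: B).
  move: (l2norm _) (l2norm A) (l2norm B) Ac Bc => x a b ac bc x0 xab.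
  have : x ^+ 2 <= (t * a + (1 - t) * b) ^+ 2 by rewrite ler_sqr ?nnegrE//; lra.
  have := ler_conv t0 t1 ac bc.
  (* This is exactly [t a^2 + (1 - t) b^2 - (t a + (1 - t) b)^2], so it expresses the convexity of
     the square. *)
  have : 0 <= t * (1 - t) * (a - b) ^+ 2.
    by apply: mulr_ge0; [rewrite mulr_ge0 ?subr_ge0|rewrite sqr_ge0].
  lra.
have colE j : col j (t *: V + (1 - t) *: W) = t *: col j V + (1 - t) *: col j W.
  by rewrite linearD/= !linearZ.
split=> [j|j1 j2 j12|j|].
- by rewrite colE; apply: sqr_conv.
- have [V2p V2m] := V2 _ _ j12; have [W2p W2m] := W2 _ _ j12; rewrite !colE.
  split; rewrite ?opprD addrACA -?scalerBr -?scalerDr.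
    exact: sqr_conv V2p W2p.
  exact: sqr_conv V2m W2m.
- rewrite colE; apply: le_trans (ler_conv t0 t1 (V3 j) (W3 j)).
  rewrite /l1norm !mulr_sumr -big_split/=; apply: ler_sum => i _.
  rewrite !mulr_sumr -big_split/=; apply: ler_sum => l _; rewrite !mxE.
  rewrite (le_trans (ler_normD _ _))// !normrM (ger0_norm t0).
  by rewrite (@ger0_norm _ (1 - t)) ?subr_ge0.
- apply: le_trans (ler_conv t0 t1 V4 W4).
  rewrite !mulr_sumr -big_split/=; apply: ler_sum => i _.
  by rewrite linearD/= !linearZ/=; apply: l2norm_conv.
Qed.

(** Cauchy-Schwarz of [a] against the indicator function of [S]. *)
Lemma sum_le_sqrt_card (I : finType) (S : {set I}) (a : I -> R) :
  (forall i, 0 <= a i) -> (forall i, i \notin S -> a i = 0) ->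
  \sum_i a i <= Num.sqrt (#|S|%:R * \sum_i a i ^+ 2).
Proof.
move=> a0 aS; rewrite -ler_sqr ?nnegrE ?sumr_ge0 ?sqrtr_ge0//.
rewrite sqr_sqrtr ?mulr_ge0 ?sumr_ge0// => [|i _]; last exact: sqr_ge0.
have := Cauchy_Schwarz (fun i => (i \in S)%:R) a.
have -> : \sum_i (i \in S)%:R * a i = \sum_i a i.
  apply: eq_bigr => i _.
  by case: (boolP (i \in S)) => [|/aS ->]; rewrite ?mul1r ?mulr0.
have -> // : \sum_i (i \in S)%:R ^+ 2 = #|S|%:R :> R.
rewrite -sumr_const [RHS]big_mkcond/=; apply: eq_bigr => i _.
by case: ifP; rewrite ?expr1n ?expr0n.
Qed.

(** Orthonormality makes the first two families of constraints equalities, since the cross terms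
    vanish. For the other two, [sum_le_sqrt_card] is applied to the nonzero rows: the squares sum to
    1 over one column and to [r] over all rows. *)
Lemma calF_sub_CR2 : @calF R d r k `<=` @CR2 R d r k.
Proof.
move=> V [VV Vk].
have VVE j1 j2 : \sum_i V i j1 * V i j2 = (j1 == j2)%:R.
  have := congr1 (fun M : 'M_r => M j1 j2) VV; rewrite !mxE => <-.
  by apply: eq_bigr => i _; rewrite mxE.
have col_sqr j : \sum_i V i j ^+ 2 = 1.
  by under eq_bigr do rewrite expr2; rewrite VVE eqxx.
have supp (i : 'I_d) : i \notin [set i : 'I_d | row i V != 0]%SET -> row i V = 0.
  by rewrite inE negbK => /eqP.
have sqrt_le (c : R) : 0 <= c ->
    Num.sqrt ((row_sparsity V)%:R * c) <= Num.sqrt (k%:R * c).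
  by move=> c0; rewrite ler_wsqrtr// ler_wpM2r// ler_nat.
split=> [j|j1 j2 j12|j|].
- by rewrite l2norm_sqr; under eq_bigr do rewrite big_ord1 mxE; rewrite col_sqr.
- have V12 : \sum_i V i j1 * V i j2 = 0 by rewrite VVE (negbTE j12).
  rewrite !l2norm_sqr; split.
    rewrite (_ : \sum_i _ = \sum_i V i j1 ^+ 2 + \sum_i V i j2 ^+ 2 +
        2 * \sum_i V i j1 * V i j2).
      by rewrite !col_sqr V12; lra.
    rewrite mulr_sumr -!big_split/=; apply: eq_bigr => i _.
    by rewrite big_ord1 !mxE/=; ring.
  rewrite (_ : \sum_i _ = \sum_i V i j1 ^+ 2 + \sum_i V i j2 ^+ 2 +
      (- 2) * \sum_i V i j1 * V i j2).
    by rewrite !col_sqr V12; lra.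
  rewrite mulr_sumr -!big_split/=; apply: eq_bigr => i _.
  by rewrite big_ord1 !mxE/=; ring.
- rewrite /l1norm; under eq_bigr do rewrite big_ord1 mxE.
  apply: le_trans (sum_le_sqrt_card (S := [set i : 'I_d | row i V != 0]%SET) _ _) _.
  + by move=> i; rewrite normr_ge0.
  + by move=> i /supp /rowP /(_ j); rewrite !mxE => ->; rewrite normr0.
  + have -> : \sum_i `|V i j| ^+ 2 = 1.
      by rewrite -(col_sqr j); apply: eq_bigr => i _; rewrite real_normK ?num_real.
    by rewrite (le_trans (sqrt_le 1 _))// mulr1.
- apply: le_trans (sum_le_sqrt_card (S := [set i : 'I_d | row i V != 0]%SET) _ _) _.
  + by move=> i; rewrite l2norm_ge0.
  + by move=> i /supp ->; rewrite l2norm0.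
  + have -> : \sum_i l2norm (row i V) ^+ 2 = r%:R.
      under eq_bigr => i _.
        rewrite l2norm_sqr big_ord1; under eq_bigr do rewrite mxE; over.
      rewrite exchange_big/=; under eq_bigr do rewrite col_sqr.
      by rewrite sumr_const card_ord.
    by rewrite (le_trans (sqrt_le r%:R _))// -natrM mulnC.
Qed.

Lemma conv_hull_calF_sub_CR2 : conv_hull (@calF R d r k) `<=` @CR2 R d r k.
Proof. exact: smallest_sub CR2_convex calF_sub_CR2. Qed.

End CR2_outer.

(** * Second-order cone representability *)

Section soc_sets.
Variables (R : realType) (n : nat).
Implicit Types P : 'cV[R]_n -> Prop.

(** Representability without auxiliary coordinates: finite intersections are then just
    concatenations of constraint lists, and the projection is taken once, in
    [CR2_soc_representable]. *)
Definition soc_set P := exists (q : nat) (g : 'I_q -> constraint R n),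
  forall x, P x <-> forall i, satisfies x (g i).

Lemma soc_set_iff P Q : (forall x, P x <-> Q x) -> soc_set P -> soc_set Q.
Proof. by move=> PQ [q [g Pg]]; exists q, g => x; rewrite -PQ. Qed.

Lemma soc_setT : soc_set (fun=> True).
Proof.
by exists 0%N, (fun=> LinearLe 0 0) => x; split => // _ [].
Qed.

Lemma soc_setI P Q : soc_set P -> soc_set Q -> soc_set (fun x => P x /\ Q x).
Proof.
move=> [q [g Pg]] [q' [g' Qg']].
exists (q + q')%N, (fun i => match split i with inl j => g j | inr j => g' j end).
move=> x; rewrite Pg Qg'; split=> [[Px Qx] i|PQx]; first by case: split.
by split=> i; [have := PQx (unsplit (inl i))|have := PQx (unsplit (inr i))];
  rewrite unsplitK.
Qed.

Lemma soc_set_forall (I : finType) (F : I -> 'cV[R]_n -> Prop) :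
  (forall i, soc_set (F i)) -> soc_set (fun x => forall i, F i x).
Proof.
move=> socF.
suff /(_ (enum I)) : forall s : seq I,
    soc_set (fun x => forall i, i \in s -> F i x).
  by apply: soc_set_iff => x; split=> H i; [apply: H; rewrite mem_enum|move=> _].
elim=> [|i s IHs]; first by apply: soc_set_iff soc_setT.
apply: soc_set_iff (soc_setI (socF i) IHs) => x; split=> [[Fi Fs] j|H].
  by rewrite inE => /orP[/eqP ->|/Fs].
by split=> [|j js]; apply: H; rewrite inE ?eqxx ?js ?orbT.
Qed.

(** Turns an abstract linear map into the explicit matrix that a [constraint] must carry. *)
Lemma linear_cVE m (f : 'cV[R]_n -> 'cV[R]_m) : linear f ->
  forall x, f x = \matrix_(i, j) f (delta_mx j 0) i 0 *m x.
Proof.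
move=> lf x.
pose fL : {linear 'cV[R]_n -> 'cV[R]_m} :=
  HB.pack f (GRing.isLinear.Build _ _ _ _ f lf).
rewrite -[f]/(fL : _ -> _).
rewrite {1}(matrix_sum_delta x) linear_sum; apply/colP => i.
rewrite summxE !mxE; apply: eq_bigr => j _.
by rewrite big_ord1 linearZ/= !mxE mulrC.
Qed.

(** A matrix-valued [f] is flattened by [mxvec], which keeps the entrywise norm, and [h] is viewed
    as a map to columns of length 1; [linear_cVE] then provides the data of a single cone
    constraint. *)
Lemma soc_set_l2norm_le m p (f : 'cV[R]_n -> 'M[R]_(m, p)) (h : 'cV[R]_n -> R)
    (e : R) : linear f -> linear (h : 'cV[R]_n -> R^o) ->
  soc_set (fun x => l2norm (f x) <= h x + e).
Proof.
move=> lf lh.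
pose f' x : 'cV[R]_(m * p) := (mxvec (f x))^T.
pose h' x : 'cV[R]_1 := const_mx (h x).
have lf' : linear f' by move=> t x y; rewrite /f' lf !linearD/= !linearZ.
have lh' : linear h' by move=> t x y; apply/matrixP => i j; rewrite /h' lh !mxE.
exists 1%N, (fun=> SecondOrderCone (\matrix_(i, j) f' (delta_mx j 0) i 0) 0
  (\matrix_(i, j) h' (delta_mx i 0) 0 0) e) => x.
suff -> : (l2norm (f x) <= h x + e) = satisfies x (SecondOrderCone
  (\matrix_(i, j) f' (delta_mx j 0) i 0) 0
  (\matrix_(i, j) h' (delta_mx i 0) 0 0) e) :> Prop.
  by split=> [//|/(_ ord0)].
rewrite /satisfies -linear_cVE// addr0; congr (is_true (_ <= _ + _)).
  rewrite /l2norm /f'; congr Num.sqrt.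
  under [RHS]eq_bigr do rewrite big_ord1 mxE.
  rewrite (reindex _ (curry_mxvec_bij m p))/= pair_bigA/=.
  by apply: eq_bigr => -[i j] _; rewrite mxvecE.
have /matrixP/(_ 0 0) := linear_cVE lh' x.
rewrite /h' !mxE => ->; apply: eq_bigr => i _; rewrite !mxE.
by [].
Qed.

(** The degenerate cone constraint with zero left-hand side, [0 <= - h x + e]. *)
Lemma soc_set_linear_le (h : 'cV[R]_n -> R) (e : R) :
  linear (h : 'cV[R]_n -> R^o) -> soc_set (fun x => h x <= e).
Proof.
move=> lh.
have l0 : linear ((fun=> 0) : 'cV[R]_n -> 'M[R]_(1, 1)).
  by move=> t x y; rewrite scaler0 addr0.
have lNh : linear ((fun x => - h x) : 'cV[R]_n -> R^o).
  by move=> t x y; rewrite lh opprD; congr (_ + _); rewrite /GRing.scale/= mulrN.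
apply: soc_set_iff (soc_set_l2norm_le e l0 lNh) => x.
by rewrite l2norm0 addrC subr_ge0.
Qed.

End soc_sets.

(** Every signed sum is at most the l1 norm, and the signs of the entries of [A] attain it. *)
Lemma l1norm_le_sign (R : realType) m (A : 'cV[R]_m) (c : R) :
  l1norm A <= c <-> forall s : {ffun 'I_m -> bool}, \sum_i (-1) ^+ s i * A i 0 <= c.
Proof.
rewrite /l1norm; under eq_bigr do rewrite big_ord1.
split=> [Ac s|].
  apply: le_trans Ac; apply: ler_sum => i _.
  by rewrite (le_trans (ler_norm _))// normrMsign.
move=> /(_ [ffun i => A i 0 < 0]); apply: le_trans; apply: ler_sum => i _.
by rewrite ffunE -normrEsign.
Qed.

(* The l1 constraints become 2^d linear inequalities per column; the auxiliary
   variables bound the row norms. *)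
Lemma CR2_soc_representable (R : realType) (d r k : nat) :
  soc_representable (@CR2 R d r k).
Proof.
pose mat (x : 'cV[R]_(d * r + d)) : 'M[R]_(d, r) := vec_mx (usubmx x)^T.
pose aux (x : 'cV[R]_(d * r + d)) : 'cV[R]_d := dsubmx x.
have lmat : linear mat by move=> t x y; rewrite /mat !linearD/= !linearZ.
have laux : linear aux by move=> t x y; rewrite /aux linearD/= linearZ.
have l0 : linear ((fun=> 0) : 'cV[R]_(d * r + d) -> R^o).
  by move=> t x y; rewrite scaler0 addr0.
have sqr_le m n (A : 'M[R]_(m, n)) (c : R) : 0 <= c ->
    (l2norm A ^+ 2 <= c) = (l2norm A <= Num.sqrt c).
  move=> c0; rewrite -[in LHS](sqr_sqrtr c0).
  by rewrite ler_sqr ?nnegrE ?l2norm_ge0 ?sqrtr_ge0.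
(* Square roots replace the squared bounds because a cone constraint bounds the norm itself. Pairs
   of columns form one finite index type, handled by a single [soc_set_forall]. *)
suff [q [g Pg]] : soc_set (fun x : 'cV[R]_(d * r + d) => 
  [/\ forall j : 'I_r, l2norm (col j (mat x)) <= Num.sqrt 1,
    forall p : 'I_r * 'I_r, p.1 != p.2 ->
      l2norm (col p.1 (mat x) + col p.2 (mat x)) <= Num.sqrt 2 /\
      l2norm (col p.1 (mat x) - col p.2 (mat x)) <= Num.sqrt 2,
    forall (j : 'I_r) (s : {ffun 'I_d -> bool}),
      \sum_i (-1) ^+ s i * col j (mat x) i 0 <= Num.sqrt k%:R
  & (forall i : 'I_d, l2norm (row i (mat x)) <= aux x i 0) /\
    \sum_i aux x i 0 <= Num.sqrt (r * k)%:R]).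
  exists d, q, g; apply/seteqP; split=> V /=.
    move=> [V1 V2 V3 V4].
    exists (\col_i l2norm (row i V)); apply/Pg.
    rewrite /mat /aux col_mxKu col_mxKd trmxK mxvecK; split.
    + by move=> j; rewrite -sqr_le.
    + by move=> p /V2[? ?]; rewrite -!sqr_le.
    + by move=> j; apply/l1norm_le_sign.
    + by split=> [i|]; [rewrite mxE|under eq_bigr do rewrite mxE].
  move=> [y /Pg]; rewrite /mat /aux col_mxKu col_mxKd trmxK mxvecK.
  move=> [V1 V2 V3 [V4 V5]]; split.
  + by move=> j; rewrite sqr_le.
  + by move=> j1 j2 j12; rewrite !sqr_le//; apply: (V2 (j1, j2)).
  + by move=> j; apply/l1norm_le_sign.
  + by apply: le_trans V5; apply: ler_sum => i _.
have cone m p (f : 'cV[R]_(d * r + d) -> 'M[R]_(m, p)) (lf : linear f) (e : R) :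
    soc_set (fun x => l2norm (f x) <= e).
  by apply: soc_set_iff (soc_set_l2norm_le e lf l0) => x; rewrite add0r.
suff : soc_set (fun x : 'cV[R]_(d * r + d) => 
  ((forall j : 'I_r, l2norm (col j (mat x)) <= Num.sqrt 1) /\
   (forall p : 'I_r * 'I_r, p.1 != p.2 ->
      l2norm (col p.1 (mat x) + col p.2 (mat x)) <= Num.sqrt 2 /\
      l2norm (col p.1 (mat x) - col p.2 (mat x)) <= Num.sqrt 2)) /\
   (forall (j : 'I_r) (s : {ffun 'I_d -> bool}),
      \sum_i (-1) ^+ s i * col j (mat x) i 0 <= Num.sqrt k%:R) /\
   (forall i : 'I_d, l2norm (row i (mat x)) <= aux x i 0) /\
    \sum_i aux x i 0 <= Num.sqrt (r * k)%:R).
  by apply: soc_set_iff => x; split=> [[[? ?] [? ?]]|[? ? ? ?]].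
apply: soc_setI; first apply: soc_setI.
- apply: soc_set_forall => j; apply: cone => t x y.
  by rewrite lmat linearD linearZ.
- apply: soc_set_forall => -[j1 j2]/=.
  (* For equal indices the premise is false and nothing is imposed. *)
  have [_|_] := eqVneq j1 j2; first by apply: soc_set_iff (soc_setT _ _).
  have : soc_set (fun x : 'cV[R]_(d * r + d) =>
      l2norm (col j1 (mat x) + col j2 (mat x)) <= Num.sqrt 2 /\
      l2norm (col j1 (mat x) - col j2 (mat x)) <= Num.sqrt 2).
    apply: soc_setI; apply: cone => t x y; rewrite lmat;
      by apply/matrixP => a b; rewrite !mxE; ring.
  by apply: soc_set_iff => x; split=> [//|]; apply.
apply: soc_setI; last apply: soc_setI.
- apply: soc_set_forall => j; apply: soc_set_forall => s.
  apply: soc_set_linear_le => t x y.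
  rewrite lmat scaler_sumr -big_split/=; apply: eq_bigr => i _.
  by rewrite linearD linearZ/= !mxE mulrDr mulrCA.
- apply: soc_set_forall => i.
  have lrow : linear (fun x : 'cV[R]_(d * r + d) => row i (mat x)).
    by move=> t x y; rewrite lmat linearD linearZ.
  have lauxi : linear ((fun x => aux x i 0) : 'cV[R]_(d * r + d) -> R^o).
    by move=> t x y; rewrite laux !mxE.
  by apply: soc_set_iff (soc_set_l2norm_le 0 lrow lauxi) => x; rewrite addr0.
- apply: soc_set_linear_le => t x y.
  by rewrite laux scaler_sumr -big_split/=; apply: eq_bigr => i _; rewrite !mxE.
Qed.

(** * Existence of a top singular vector *)

(** The continuous function [l2norm (v *m M) ^+ 2] attains its maximum on the compact unit sphere,
    and homogeneity extends the bound to all [w]. The size [n.+1] makes the sphere nonempty. *)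
Lemma exists_top_singular_vector (R : realType) m n (M : 'M[R]_(n.+1, m)) :
  exists2 v : 'rV[R]_n.+1, l2norm v = 1 &
    forall w : 'rV[R]_n.+1,
      l2norm (w *m M) ^+ 2 <= l2norm (v *m M) ^+ 2 * l2norm w ^+ 2.
Proof.
have cont_sqr p (f : 'rV[R]_n.+1 -> 'rV[R]_p) :
    (forall j : 'I_p, continuous (fun v : 'rV[R]_n.+1 => f v 0 j)) ->
    continuous (fun v : 'rV[R]_n.+1 => l2norm (f v) ^+ 2).
  move=> cf; rewrite (_ : (fun v => _) = (fun v => \sum_j f v 0 j * f v 0 j)).
    apply: (continuous_big add_continuous) => j _ v.
    exact: (cvgM (cf j v) (cf j v)).
  apply/funext => v; rewrite l2norm_sqr big_ord1.
  by apply: eq_bigr => j _; rewrite expr2.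
have cont_coord j : continuous (fun v : 'rV[R]_n.+1 => v 0 j).
  exact: coord_continuous.
pose S := [set v : 'rV[R]_n.+1 | l2norm v ^+ 2 = 1].
(* The sphere is compact as a closed subset of a cube, itself a product of segments. *)
have S_box : S `<=` [set v : 'rV[R]_n.+1 | forall i, v ord0 i \in `[-1, 1]].
  move=> v; rewrite /S/= l2norm_sqr big_ord1 => v1 i.
  rewrite in_itv/= -ler_norml -(@ler_sqr _ _ 1) ?nnegrE// real_normK ?num_real//.
  rewrite expr1n -v1 (bigD1 i)//= lerDl; apply: sumr_ge0 => j _.
  exact: sqr_ge0.
have S_closed : closed S.
  apply: (preimage_closed _ (@closed_eq R 1)) => v _.
  exact: (cont_sqr _ id).
have S_compact : compact S.
  apply: subclosed_compact S_closed _ S_box.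
  apply: (@rV_compact _ _ (fun=> `[(-1 : R), 1]%classic)) => _.
  exact: segment_compact.
have S_nonempty : S !=set0.
  exists (delta_mx 0 0); rewrite /S/= l2norm_sqr big_ord1 (bigD1 0)//= big1.
    by rewrite mxE !eqxx expr1n addr0.
  by move=> j /negbTE j0; rewrite mxE j0 andbF expr0n.
have cont_f : continuous (fun v : 'rV[R]_n.+1 => l2norm (v *m M) ^+ 2).
  apply: cont_sqr => j.
  rewrite (_ : (fun v => _) = fun v : 'rV[R]_n.+1 => \sum_k v 0 k * M k j); last first.
    by apply/funext => v; rewrite mxE.
  apply: (continuous_big add_continuous) => k _ v.
  exact: (cvgMr_tmp (cont_coord k v)).
have [v vS vmax] := compact_EVT_max S_nonempty S_compact
  (continuous_subspaceT cont_f).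
have v1 : l2norm v = 1.
  move: vS; rewrite inE /S/= => /eqP; rewrite sqrf_eq1 => /orP[/eqP//|/eqP vN1].
  by have := l2norm_ge0 v; rewrite vN1 ler0N1.
exists v => // w.
have [w0|w0] := eqVneq (l2norm w) 0.
  by rewrite (l2norm_eq0 w0) mul0mx !l2norm0 expr0n mulr0.
have := vmax ((l2norm w)^-1 *: w).
rewrite inE /S/= -scalemxAl !l2normZ ger0_norm ?invr_ge0 ?l2norm_ge0//.
rewrite mulVf// expr1n => /(_ erefl).
by rewrite exprMn exprVn mulrC ler_pdivrMr// exprn_gt0// lt_def w0 l2norm_ge0.
Qed.

Lemma convex_set_preimage (R : realType) (M N : lmodType R) (f : M -> N)
    (C : set N) :
  (forall t x y, f (t *: x + (1 - t) *: y) = t *: f x + (1 - t) *: f y) ->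
  @convex_set R N C -> @convex_set R M (f @^-1` C).
Proof.
move=> faff /convex_setP cC; apply/convex_setP => t x y t0 t1 Cx Cy.
by rewrite /preimage/= faff; apply: cC.
Qed.

(** * Orthogonal maps and splitting off one singular value *)

Section Frobenius.
Variable R : realType.

Lemma l2norm_sqr_tr m n (A : 'M[R]_(m, n)) : l2norm A ^+ 2 = \tr (A *m A^T).
Proof.
rewrite l2norm_sqr; apply: eq_bigr => i _; rewrite mxE.
by apply: eq_bigr => j _; rewrite mxE expr2.
Qed.

Lemma l2norm_tr m n (A : 'M[R]_(m, n)) : l2norm A^T = l2norm A.
Proof.
rewrite /l2norm exchange_big/=; congr Num.sqrt.
by apply: eq_bigr => i _; apply: eq_bigr => j _; rewrite mxE.
Qed.

Lemma l2norm_mulmx_isometry m n p (A : 'M[R]_(m, n)) (Q : 'M[R]_(n, p)) :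
  Q *m Q^T = 1%:M -> l2norm (A *m Q) = l2norm A.
Proof.
move=> QQ; apply/eqP; rewrite -(@eqrXn2 _ 2) ?l2norm_ge0// !l2norm_sqr_tr.
by rewrite trmx_mul mulmxA -(mulmxA A) QQ mulmx1.
Qed.

Lemma l2norm_block m1 m2 n1 n2 (A : 'M[R]_(m1, n1)) (B : 'M_(m1, n2))
    (C : 'M_(m2, n1)) (D : 'M_(m2, n2)) :
  l2norm (block_mx A B C D) ^+ 2 =
  l2norm A ^+ 2 + l2norm B ^+ 2 + l2norm C ^+ 2 + l2norm D ^+ 2.
Proof.
rewrite !l2norm_sqr big_split_ord/= -!addrA addrA -!big_split/=.
congr (_ + _); apply: eq_bigr => i _; rewrite big_split_ord/=.
  by under eq_bigr do rewrite block_mxEul;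
    under [X in _ + X = _]eq_bigr do rewrite block_mxEur.
by under eq_bigr do rewrite block_mxEdl;
  under [X in _ + X = _]eq_bigr do rewrite block_mxEdr.
Qed.

Lemma l2norm_row_mx m n1 n2 (A : 'M[R]_(m, n1)) (B : 'M_(m, n2)) :
  l2norm (row_mx A B) ^+ 2 = l2norm A ^+ 2 + l2norm B ^+ 2.
Proof.
rewrite !l2norm_sqr -big_split/=.
apply: eq_bigr => i _; rewrite big_split_ord/=.
by under eq_bigr do rewrite row_mxEl;
  under [X in _ + X = _]eq_bigr do rewrite row_mxEr.
Qed.

Lemma l2norm_scalar1 (a : R) : l2norm (a%:M : 'M_1) = `|a|.
Proof. by rewrite /l2norm !big_ord1 mxE eqxx mulr1n sqrtr_sqr. Qed.

(* The Householder reflection exchanging [v] and the first basis vector. *)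
Lemma exists_orthogonal_row0 n (v : 'rV[R]_(1 + n)) : l2norm v = 1 ->
  exists H : 'M[R]_(1 + n), H *m H^T = 1%:M /\ delta_mx 0 0 *m H = v.
Proof.
move=> v1; pose e : 'rV[R]_(1 + n) := delta_mx 0 0.
pose w : 'rV[R]_(1 + n) := v - e.
(* If [v] is already the first basis vector there is no direction to reflect along, and the identity
   serves. *)
have [w0|w_neq0] := eqVneq w 0.
  exists 1%:M; rewrite trmx1 !mulmx1; split=> //.
  by apply/esym/eqP; rewrite -subr_eq0 -/e -/w w0.
pose c : R := (w *m w^T) 0 0.
have cE : c = l2norm w ^+ 2 by rewrite l2norm_sqr_tr /mxtrace big_ord1.
have c_neq0 : c != 0.
  by rewrite cE sqrf_eq0; apply: contra w_neq0 => /eqP /l2norm_eq0 ->.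
have ee : e *m e^T = 1%:M.
  rewrite /e trmx_delta mul_delta_mx; apply/matrixP => i j.
  by rewrite !ord1 !mxE eqxx.
have vv : v *m v^T = 1%:M.
  rewrite [LHS]mx11_scalar; congr (_%:M).
  by have := l2norm_sqr_tr v; rewrite v1 expr1n /mxtrace big_ord1.
have ev : v *m e^T = e *m v^T.
  by rewrite [LHS]mx11_scalar -tr_scalar_mx -mx11_scalar trmx_mul trmxK.
(* As [e] and [v] are unit vectors, [|v - e|^2 = 2 - 2 <e, v> = - 2 <e, w>]; hence the reflection
   [1 - (2 / c) P] sends [e] to [e + w = v]. *)
have cE2 : c = - 2 * (e *m w^T) 0 0.
  rewrite /c /w linearB/= !mulmxBl !mulmxBr ee vv ev !mxE/= mulr1n; ring.
pose P := w^T *m w.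
have symP : P^T = P by rewrite trmx_mul trmxK.
have PP : P *m P = c *: P.
  rewrite /P mulmxA -(mulmxA w^T) [w *m w^T]mx11_scalar -/c.
  by rewrite mul_mx_scalar -scalemxAl.
exists (1%:M - (2 / c) *: P); split.
  have -> : (1%:M - (2 / c) *: P)^T = 1%:M - (2 / c) *: P.
    by move: P symP {PP} => P symP; rewrite linearB linearZ/= symP trmx1.
  rewrite mulmxBl mul1mx mulmxBr mulmx1 -scalemxAl -scalemxAr PP !scalerA.
  rewrite (_ : 2 / c * (2 / c) * c = 2 / c + 2 / c); last by field.
  by rewrite scalerDl opprB addrK subrK.
rewrite -/e /P mulmxBr mulmx1 -scalemxAr mulmxA [e *m w^T]mx11_scalar mul_scalar_mx.
rewrite scalerA (_ : 2 / c * _ = - 1).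
  by rewrite scaleN1r opprK /w addrC subrK.
move: c_neq0; rewrite cE2 => c_neq0; field.
by move: c_neq0; rewrite mulf_eq0 negb_or => /andP[].
Qed.

(** One step of the singular value decomposition. For a top singular vector [v], write [v X = s y]
    with [y] a unit vector, and rotate [v] and [y] to the first basis vectors: the first row becomes
    [(s, 0)], and maximality of [s] clears the rest of the first column. *)
Lemma exists_block_diagonalization k r (X : 'M[R]_(1 + k, 1 + r)) :
  exists (U : 'M[R]_(1 + k)) (V : 'M[R]_(1 + r)) (s : R) (Y : 'M[R]_(k, r)),
    [/\ U *m U^T = 1%:M, V *m V^T = 1%:M, 0 <= s &
        X = U^T *m block_mx s%:M 0 0 Y *m V].
Proof.
have [v v1 vmax] := exists_top_singular_vector X.
pose s := l2norm (v *m X).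
have [y y1 vX] : exists2 y : 'rV[R]_(1 + r), l2norm y = 1 & v *m X = s *: y.
  (* If [s = 0], any unit vector can be taken for [y]. *)
  have [s0|s_neq0] := eqVneq s 0.
    exists (delta_mx 0 0); last by rewrite s0 scale0r; apply: l2norm_eq0.
    rewrite /l2norm big_ord1 (bigD1 0)//= big1 ?mxE ?eqxx ?expr1n ?addr0 ?sqrtr1//.
    by move=> j /negbTE j0; rewrite mxE j0 andbF expr0n.
  exists (s^-1 *: (v *m X)); last by rewrite scalerA divff// scale1r.
  by rewrite l2normZ ger0_norm ?invr_ge0 ?l2norm_ge0// mulVf.
have [U [UU eU]] := exists_orthogonal_row0 v1.
have [V [VV eV]] := exists_orthogonal_row0 y1.
have UU' := mulmx1C UU; have VV' := mulmx1C VV.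
have VVt : V^T *m V^T^T = 1%:M by rewrite trmxK.
pose Z := U *m X *m V^T.
have XE : X = U^T *m Z *m V.
  by rewrite /Z -!mulmxA VV' mulmx1 mulmxA UU' mul1mx.
have row0Z : delta_mx 0 0 *m Z = s *: delta_mx 0 0 :> 'rV_(1 + r).
  by rewrite /Z !mulmxA eU vX -eV -scalemxAl -mulmxA VV mulmx1.
(* Orthogonal maps preserve norms, so [s] is maximal for [Z] too. *)
have Zmax (w : 'rV_(1 + k)) : l2norm (w *m Z) ^+ 2 <= s ^+ 2 * l2norm w ^+ 2.
  have := vmax (w *m U).
  by rewrite /Z !mulmxA !(l2norm_mulmx_isometry _ UU, l2norm_mulmx_isometry _ VVt).
clearbody Z.
have Zul : ulsubmx Z = s%:M.
  apply/matrixP => i j; rewrite !ord1 mxE mxE [RHS]mxE eqxx mulr1n.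
  have /rowP/(_ 0) := row0Z; rewrite -rowE !mxE/= mulr1 => <-.
  by congr (Z _ _); apply: val_inj.
have Zur : ursubmx Z = 0.
  apply/matrixP => i j; rewrite !ord1 mxE mxE [RHS]mxE.
  have /rowP/(_ (rshift 1 j)) := row0Z; rewrite -rowE !mxE/= mulr0 => <-.
  by congr (Z _ _); apply: val_inj.
have Zdl : dlsubmx Z = 0.
  (* Otherwise the row [(s, z^T)] would violate the maximality of [s]. *)
  pose z := dlsubmx Z.
  have := Zmax (row_mx s%:M z^T).
  rewrite -{1}(submxK Z) Zul Zur mul_row_block !l2norm_row_mx.
  rewrite l2norm_tr -scalar_mxM l2norm_scalar1 -/z.
  have -> : z^T *m z = (l2norm z ^+ 2)%:M.
    by rewrite [LHS]mx11_scalar -l2norm_tr l2norm_sqr_tr trmxK /mxtrace big_ord1.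
  rewrite -[(s * s)%:M + _]raddfD l2norm_scalar1 !real_normK ?num_real// => le_s.
  apply: l2norm_eq0; rewrite -/z; apply/eqP; rewrite -sqrf_eq0.
  move: le_s; set p := l2norm (_ + _) ^+ 2; set q := l2norm z ^+ 2 => le_s.
  have p0 : 0 <= p by exact: sqr_ge0.
  have sq0 : 0 <= s ^+ 2 * q by rewrite mulr_ge0 ?sqr_ge0.
  (* The bound reads [(s^2 + q)^2 + p <= s^2 (s^2 + q)], i.e. [s^2 q + q^2 + p <= 0] with
     nonnegative terms; so [q = 0]. *)
  by rewrite -sqrf_eq0 eq_le sqr_ge0 andbT; lra.
exists U, V, s, (drsubmx Z); split=> //; first exact: l2norm_ge0.
by rewrite {1}XE -{1}(submxK Z) Zul Zur Zdl.
Qed.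

End Frobenius.

(** * The Frobenius ball and matrices with orthonormal columns *)

(** Stated for an arbitrary convex [C] so that, in the induction on [r], the hypothesis applies to
    the preimage of [C] under the affine map [Q |-> U^T diag(s, Q) V]. For [r = 0] the matrix [X]
    itself has orthonormal columns. *)
Lemma Frobenius_ball_sub_convex (R : realType) r k (X : 'M[R]_(k, r))
    (C : set 'M[R]_(k, r)) :
  (r <= k)%N -> l2norm X <= 1 -> @convex_set R 'M[R]_(k, r) C ->
  (forall Q, Q^T *m Q = 1%:M -> C Q) -> C X.
Proof.
elim: r => [|r IHr] in k X C *; first by move=> _ _ _; apply; apply/matrixP => -[].
case: k X C => // k X C; rewrite ltnS => rk X1 cC isoC.
have [U [V [s [Y [UU VV s0 XE]]]]] := exists_block_diagonalization X.
have UU' := mulmx1C UU; have VV' := mulmx1C VV.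
have : l2norm X ^+ 2 <= 1 by rewrite expr_le1// l2norm_ge0.
(* Invariance of the norm under [U] and [V] leaves [s^2 + l2norm Y ^ 2 <= 1]. *)
rewrite XE l2norm_mulmx_isometry// -l2norm_tr trmx_mul trmxK.
rewrite l2norm_mulmx_isometry// l2norm_tr l2norm_block !l2norm0 l2norm_scalar1.
rewrite expr0n/= !addr0 ger0_norm// => sY.
have s1 : s <= 1.
  by rewrite -(@expr_le1 _ 2)//; have := sqr_ge0 (l2norm Y); lra.
have Y1 : l2norm Y <= 1.
  by rewrite -(@expr_le1 _ 2) ?l2norm_ge0//; have := sqr_ge0 s; lra.
pose g (t : R) (Q : 'M[R]_(k, r)) : 'M[R]_(1 + k, 1 + r) :=
  U^T *m block_mx t%:M 0 0 Q *m V.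
have gZ t B : t *: (U^T *m B *m V) = U^T *m (t *: B) *m V.
  by rewrite -scalemxAr -scalemxAl.
have g_aff t a b Q Q' :
    t *: g a Q + (1 - t) *: g b Q' =
    g (t * a + (1 - t) * b) (t *: Q + (1 - t) *: Q').
  rewrite /g !gZ -mulmxDl -mulmxDr !scale_block_mx.
  rewrite add_block_mx !scaler0 !addr0; congr (_ *m block_mx _ _ _ _ *m _).
  by rewrite raddfD/= !scale_scalar_mx.
have g_iso (t : R) (Q : 'M[R]_(k, r)) : t * t = 1 -> Q^T *m Q = 1%:M -> C (g t Q).
  move=> tt QQ; apply: isoC; rewrite /g !trmx_mul trmxK -!mulmxA (mulmxA U).
  rewrite UU mul1mx (mulmxA _ _ V) tr_block_mx mulmx_block.
  rewrite !trmx0 !mul0mx !mulmx0 !addr0 add0r QQ tr_scalar_mx -scalar_mxM tt.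
  by rewrite -scalar_mx_block mul1mx.
apply: (IHr k Y (g s @^-1` C)) => // [|Q QQ].
  apply: convex_set_preimage cC => t x y; rewrite g_aff; congr g.
  by rewrite -mulrDl subrKC mul1r.
(* The weight [(1 + s) / 2] on 1 and its complement on -1 average to [s]; both [g 1 Q] and
   [g (-1) Q] have orthonormal columns. *)
have [t0 t1] : 0 <= (1 + s) / 2 /\ (1 + s) / 2 <= 1 by split; lra.
move/convex_setP : cC => /(_ _ (g 1 Q) (g (-1) Q) t0 t1).
rewrite g_aff -scalerDl subrKC scale1r /preimage/=.
rewrite (_ : _ + _ = s); last by field.
by apply; apply: g_iso; rewrite ?mulrNN ?mulr1.
Qed.

(** * Row-sparse matrices and multiples of the hull *)

Section sparse.
Variables (R : realType) (d r k : nat).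
Hypotheses (hk : (0 < k)%N) (hrk : (r <= k)%N) (hkd : (k <= d)%N).
Local Notation K := (conv_hull (@calF R d r k)).
Implicit Types V W : 'M[R]_(d, r).

Let supp V := [set i : 'I_d | row i V != 0]%SET.

(** Choosing [k] row indices that include the support gives [W = E X] with [X] of size [k] by [r]
    and [E] a 0-1 matrix with orthonormal columns. Left multiplication by [E] sends matrices with
    orthonormal columns into [calF]. *)
Lemma sparse_Frobenius_ball_sub W :
  (row_sparsity W <= k)%N -> l2norm W <= 1 -> K W.
Proof.
(* Listing the support first puts it among the first [k] entries of [e]; other indices fill the
   remaining places, and [k <= d] ensures that there are enough. *)
move=> Wk W1; pose S := supp W; pose e := enum S ++ enum (~: S).
have e_uniq : uniq e.
  rewrite cat_uniq !enum_uniq/= andbT; apply/hasPn => i.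
  by rewrite !mem_enum inE.
have e_size : size e = d.
  by rewrite size_cat -!cardE cardsC card_ord.
pose i0 : 'I_d := Ordinal (leq_trans hk hkd).
pose f (a : 'I_k) := nth i0 e a.
have f_inj : injective f.
  move=> a b /eqP; rewrite nth_uniq ?e_size ?(leq_trans (ltn_ord _))//.
  by move=> /eqP/val_inj.
have f_onto i : row i W != 0 -> exists a, f a = i.
  move=> Wi; have iS : i \in S by rewrite inE.
  have ik : (index i (enum S) < k)%N.
    by rewrite (leq_trans _ Wk)// /row_sparsity cardE index_mem mem_enum.
  exists (Ordinal ik); rewrite /f/= nth_cat index_mem mem_enum iS nth_index//.
  by rewrite mem_enum.
pose E : 'M[R]_(d, k) := \matrix_(i, a) (i == f a)%:R.
have EQ n (Q : 'M[R]_(k, n)) a j : (E *m Q) (f a) j = Q a j.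
  rewrite mxE (bigD1 a)//= big1 => [|b ba]; first by rewrite mxE eqxx mul1r addr0.
  by rewrite mxE (inj_eq f_inj) eq_sym (negbTE ba) mul0r.
have EQ0 n (Q : 'M[R]_(k, n)) i j : (forall a, f a != i) -> (E *m Q) i j = 0.
  by move=> fi; rewrite mxE big1// => a _; rewrite mxE eq_sym (negbTE (fi a)) mul0r.
have EE : E^T *m E = 1%:M.
  apply/matrixP => a b; rewrite mxE (bigD1 (f b))//= big1 => [|i ib].
    by rewrite !mxE eqxx mulr1 addr0 (inj_eq f_inj) eq_sym.
  by rewrite mxE [E i b]mxE (negbTE ib) mulr0.
have WE : W = E *m rowsub f W.
  apply/matrixP => i j.
  have [/existsP[a /eqP <-]|/existsPn fi] := boolP [exists a, f a == i].
    by rewrite EQ mxE.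
  rewrite EQ0//; have [/rowP /(_ j)|/f_onto[a fa]] := eqVneq (row i W) 0.
    by rewrite !mxE.
  by have := fi a; rewrite fa eqxx.
have X1 : l2norm (rowsub f W) <= 1.
  apply: le_trans W1; rewrite {2}WE -[in leRHS]l2norm_tr trmx_mul.
  by rewrite l2norm_mulmx_isometry ?trmxK// l2norm_tr.
rewrite WE; apply: (Frobenius_ball_sub_convex (C := mulmx E @^-1` K)) => //.
  apply: convex_set_preimage => [t x y|].
    by rewrite mulmxDr !scalemxAr.
  by apply/convex_setP => t x y; apply: conv_hull_convex.
move=> Q QQ; apply: sub_gen_smallest; split.
  by rewrite trmx_mul -mulmxA (mulmxA _ E) EE mul1mx.
(* The nonzero rows of [E Q] lie in the image of [f], which has [k] elements. *)
rewrite /row_sparsity -[leqRHS]card_ord -(card_imset predT f_inj).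
apply/subset_leq_card/fintype.subsetP => i; rewrite inE => Qi.
apply/imsetP.
have [/existsP[a /eqP <-]|/existsPn fi] := boolP [exists a, f a == i].
  by exists a.
by case/eqP: Qi; apply/rowP => j; rewrite !mxE -[RHS](EQ0 _ Q i j fi) mxE.
Qed.

Lemma conv_hull_calF0 : K 0.
Proof.
apply: sparse_Frobenius_ball_sub; rewrite ?l2norm0//.
by rewrite /row_sparsity eq_card0// => i; rewrite !inE linear0 eqxx.
Qed.

(** For [a + b > 0], the sum is [a + b] times the convex combination with weights [a / (a + b)] and
    [b / (a + b)]. *)
Lemma scale_conv_hullD (a b : R) V W : 0 <= a -> 0 <= b ->
  scale_set a K V -> scale_set b K W -> scale_set (a + b) K (V + W).
Proof.
move=> a0 b0 [V' KV <-] [W' KW <-].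
have [ab0|ab_neq0] := eqVneq (a + b) 0.
  exists V' => //; have /eqP := ab0; rewrite paddr_eq0// => /andP[/eqP -> /eqP ->].
  by rewrite addr0 !scale0r addr0.
have ab_gt0 : 0 < a + b by rewrite lt_def ab_neq0 addr_ge0.
exists (a / (a + b) *: V' + (1 - a / (a + b)) *: W').
  apply: conv_hull_convex => //; first by rewrite divr_ge0// addr_ge0.
  by rewrite ler_pdivrMr// mul1r lerDl.
rewrite scalerDr !scalerA mulrBr mulrCA divff// !mulr1.
by rewrite addrAC subrr add0r.
Qed.

(** Since 0 lies in the hull, it can be added with the missing weight [b - a]. *)
Lemma scale_conv_hull_le (a b : R) V : 0 <= a -> a <= b ->
  scale_set a K V -> scale_set b K V.
Proof.
move=> a0 ab KV; rewrite -[V]addr0 -(subrKC a b).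
apply: scale_conv_hullD => //; first by rewrite subr_ge0.
by exists 0; [exact: conv_hull_calF0|rewrite scaler0].
Qed.

Lemma scale_conv_hull_sparse (b : R) V :
  (row_sparsity V <= k)%N -> l2norm V <= b -> scale_set b K V.
Proof.
move=> Vk Vb; have b0 := le_trans (l2norm_ge0 V) Vb.
have [bE|b_neq0] := eqVneq b 0.
  exists 0; first exact: conv_hull_calF0.
  by rewrite scaler0; apply/esym/l2norm_eq0/eqP; rewrite eq_le l2norm_ge0 -bE Vb.
exists (b^-1 *: V); last by rewrite scalerA divff// scale1r.
apply: sparse_Frobenius_ball_sub.
  apply: leq_trans Vk; apply/subset_leq_card/fintype.subsetP => i.
  by rewrite !inE linearZ/=; apply: contra => /eqP ->; rewrite scaler0.
by rewrite l2normZ ger0_norm ?invr_ge0// mulrC ler_pdivrMr ?mul1r// lt_def b_neq0.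
Qed.

(** * Second inclusion: cutting a matrix into blocks of rows *)

Definition row_restrict (A : {set 'I_d}) V : 'M[R]_(d, r) :=
  \matrix_(i, j) if i \in A then V i j else 0.

Lemma row_row_restrict A V i :
  row i (row_restrict A V) = if i \in A then row i V else 0.
Proof. by apply/rowP => j; rewrite !mxE; case: ifP; rewrite !mxE. Qed.

Lemma l2norm_rows V : l2norm V ^+ 2 = \sum_i l2norm (row i V) ^+ 2.
Proof.
rewrite l2norm_sqr; apply: eq_bigr => i _; rewrite l2norm_sqr big_ord1.
by apply: eq_bigr => j _; rewrite mxE.
Qed.

Lemma l2norm_row_restrict A V :
  l2norm (row_restrict A V) ^+ 2 = \sum_(i in A) l2norm (row i V) ^+ 2.
Proof.
rewrite l2norm_rows [RHS]big_mkcond/=; apply: eq_bigr => i _.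
by rewrite row_row_restrict; case: ifP => // _; rewrite l2norm0 expr0n.
Qed.

Lemma row_restrict_setC A V : V = row_restrict A V + row_restrict (~: A) V.
Proof.
by apply/matrixP => i j; rewrite !mxE inE; case: ifP; rewrite ?addr0 ?add0r.
Qed.

(** The set is built by repeatedly adding a maximizer of [f] on the complement. *)
Lemma exists_top_set (I : finType) (f : I -> R) n : (n <= #|I|)%N ->
  exists2 A : {set I}, #|A| = n &
    forall i j, i \in A -> j \notin A -> f j <= f i.
Proof.
elim: n => [_|n IHn nI].
  by exists (finset.set0) => [|i j]; rewrite ?cards0 ?inE.
have [A An Atop] := IHn (ltnW nI).
have /card_gt0P[i0 i0A] : (0 < #|~: A|)%N.
  by rewrite cardsCs finset.setCK An subn_gt0.
pose m := [arg max_(i > i0 in ~: A) f i]%O.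
have [mA m_max] : m \in ~: A /\ forall j, j \in ~: A -> f j <= f m.
  by rewrite /m; case: arg_maxP.
exists (m |: A)%SET; first by move: mA; rewrite inE cardsU1 An => ->.
move=> i j; rewrite !inE negb_or => /orP[/eqP ->|iA] /andP[_ jA].
  by apply: m_max; rewrite inE.
exact: Atop.
Qed.

(* After a top block [A] is removed, each remaining row norm is at most the mean
   over [A], so the recursive call takes (sum of row norms over [A]) / sqrt k
   for [b]. *)
Lemma greedy_scale_conv_hull V (b : R) : 0 <= b ->
  (forall A : {set 'I_d}, (#|A| <= k)%N -> l2norm (row_restrict A V) <= b) ->
  scale_set (b + (\sum_i l2norm (row i V)) / Num.sqrt k%:R) K V.
Proof.
have [n] := ubnP (row_sparsity V); elim: n => // n IHn in V b *.
rewrite ltnS => Vn b0 Vb.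
have sqrtk0 : 0 < Num.sqrt k%:R :> R by rewrite sqrtr_gt0 ltr0n.
have sum0 (P : pred 'I_d) W : 0 <= \sum_(i | P i) l2norm (row i W).
  by apply: sumr_ge0 => i _; apply: l2norm_ge0.
have [Vk|Vk] := leqP (row_sparsity V) k.
  apply: (scale_conv_hull_le b0); first by rewrite lerDl divr_ge0// ltW.
  apply: scale_conv_hull_sparse => //.
  rewrite (_ : V = row_restrict (supp V) V); first exact: Vb.
  apply/row_matrixP => i; rewrite row_row_restrict inE.
  by case: eqVneq.
have [|A Ak Atop] := @exists_top_set 'I_d (fun i => l2norm (row i V)) k.
  by rewrite card_ord.
pose W := row_restrict (~: A) V.
pose sA := \sum_(i in A) l2norm (row i V).
have sumV : \sum_i l2norm (row i V) = sA + \sum_i l2norm (row i W).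
  rewrite (bigID (mem A))/=; congr (_ + _).
  rewrite big_mkcond/=; apply: eq_bigr => i _.
  by rewrite row_row_restrict inE; case: ifP => // _; rewrite l2norm0.
have le_mean i : l2norm (row i W) <= sA / k%:R.
  rewrite row_row_restrict inE; case: ifPn => [iA|_]; last first.
    by rewrite l2norm0 divr_ge0// sum0.
  rewrite ler_pdivlMr ?ltr0n// mulr_natr -Ak -sumr_const.
  by apply: ler_sum => j jA; apply: Atop.
(* As [V] has more than [k] nonzero rows, one lies outside [A]; by the choice of [A] no row in [A]
   vanishes, so removing [A] lowers the sparsity. *)
have Wn : (row_sparsity W < n)%N.
  apply: leq_trans Vn; apply: proper_card; apply/properP; split.
    apply/fintype.subsetP => i; rewrite !inE row_row_restrict.
    by case: ifP => //; rewrite eqxx.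
  have /subsetPn[j] : ~~ (supp V \subset A).
    by apply: contraL Vk => /subset_leq_card; rewrite Ak -leqNgt.
  have /card_gt0P[i iA] : (0 < #|A|)%N by rewrite Ak.
  rewrite inE => Vj jA; exists i; rewrite inE.
    apply: contra Vj => /eqP Vi; have := Atop _ _ iA jA.
    rewrite Vi l2norm0 => Vj; apply/eqP/l2norm_eq0/eqP.
    by rewrite eq_le Vj l2norm_ge0.
  by rewrite row_row_restrict inE iA negbK.
have sAk0 : 0 <= sA / Num.sqrt k%:R by rewrite divr_ge0 ?sum0// ltW.
rewrite sumV mulrDl addrA [X in scale_set _ _ X](row_restrict_setC A).
rewrite -addrA; apply: scale_conv_hullD => //.
- by rewrite addr_ge0// divr_ge0 ?sum0// ltW.
- apply: scale_conv_hull_sparse; last by rewrite Vb ?Ak.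
  rewrite -Ak; apply/subset_leq_card/fintype.subsetP => i.
  by rewrite inE row_row_restrict; case: ifP; rewrite ?eqxx.
apply: IHn => // B Bk.
rewrite -ler_sqr ?nnegrE ?l2norm_ge0// l2norm_row_restrict.
rewrite expr_div_n sqr_sqrtr//.
(* At most [k] rows, each of norm at most [sA / k], have squared norms adding up to at most
   [k (sA / k)^2 = sA^2 / k]. *)
have -> : sA ^+ 2 / k%:R = \sum_(i < k) (sA / k%:R) ^+ 2.
  by rewrite sumr_const card_ord -mulr_natr; field; rewrite pnatr_eq0 -lt0n.
rewrite sumr_const card_ord.
apply: (@le_trans _ _ (\sum_(i in B) (sA / k%:R) ^+ 2)).
  by apply: ler_sum => i _; rewrite ler_sqr ?nnegrE ?l2norm_ge0// divr_ge0// sum0.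
by rewrite sumr_const -!(mulr_natr (_ ^+ 2)) ler_wpM2l ?sqr_ge0 ?ler_nat.
Qed.

Lemma CR2_sub_scale_conv_hull :
  @CR2 R d r k `<=` scale_set (2 * Num.sqrt r%:R) K.
Proof.
move=> V [V1 _ _ V4].
have sqrtk0 : 0 < Num.sqrt k%:R :> R by rewrite sqrtr_gt0 ltr0n.
have sqrtr0 : 0 <= Num.sqrt r%:R :> R by exact: sqrtr_ge0.
apply: scale_conv_hull_le (greedy_scale_conv_hull sqrtr0 _).
- rewrite addr_ge0// divr_ge0 ?sqrtr_ge0//.
  by apply: sumr_ge0 => i _; apply: l2norm_ge0.
- rewrite mulr2n mulrDl mul1r lerD2l ler_pdivrMr// -sqrtrM// -natrM.
  exact: V4.
move=> A _; rewrite -ler_sqr ?nnegrE ?l2norm_ge0// (sqr_sqrtr (ler0n R r)).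
(* Dropping rows lowers the norm, and the [r] columns contribute at most 1 each. *)
apply: (@le_trans _ _ (l2norm V ^+ 2)).
  rewrite l2norm_row_restrict l2norm_rows [leRHS](bigID (mem A))/= lerDl.
  by apply: sumr_ge0 => i _; apply: sqr_ge0.
rewrite l2norm_sqr exchange_big/=.
rewrite -[X in _ <= X%:R]card_ord -sumr_const; apply: ler_sum => j _.
apply: le_trans (V1 j); rewrite l2norm_sqr; apply: ler_sum => i _.
by rewrite big_ord1 mxE.
Qed.

End sparse.

Theorem theorem3 (R : realType) (d r k : nat)
    (hr : (1 <= r)%N) (hrk : (r <= k)%N) (hkd : (k <= d)%N) :
  soc_representable (@CR2 R d r k) /\
  exists rho : R,
    [/\ 0 <= rho, rho <= 2 * Num.sqrt r%:R,
        conv_hull (@calF R d r k) `<=` @CR2 R d r k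
      & @CR2 R d r k `<=` scale_set rho (conv_hull (@calF R d r k))].
Proof.
split; first exact: CR2_soc_representable.
exists (2 * Num.sqrt r%:R); split.
- by rewrite mulr_ge0 ?sqrtr_ge0.
- by [].
- exact: conv_hull_calF_sub_CR2.
- by apply: CR2_sub_scale_conv_hull => //; apply: leq_trans hrk.
Qed.
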